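(* Let $P$ be the finite powerset monad and $M$ the finite multiset monad on $\mathbf{Set}$. There is no distributive law of type $PM \Rightarrow MP$.
   Context: The finite covariant powerset monad $(P,\eta^P,\mu^P)$: $PX$ is the set of finite subsets of $X$, $P$ acts on functions by direct image, $\eta^P_X(x)=\{x\}$, $\mu^P_X$ is union. The multiset monad $(M,\eta^M,\mu^M)$: $MX$ is the set of functions $X\to\mathbb{N}$ with finite support (finite multisets), $M$ acts on functions by summing multiplicities over fibres, $\eta^M_X(x)$ is the multiset containing $x$ with multiplicity $1$, and $\mu^M_X(\Phi)(x)=\sum_{m}\Phi(m)\,m(x)$. For monads $(S,\eta^S,\mu^S)$, $(T,\eta^T,\mu^T)$, a distributive law $\lambda: ST \Rightarrow TS$ is a natural transformation with $\lambda\cdot\eta^S T = T\eta^S$, $\lambda\cdot S\eta^T=\eta^T S$, $\lambda\cdot\mu^S T = T\mu^S\cdot\lambda S\cdot S\lambda$ and $\lambda\cdot S\mu^T=\mu^T S\cdot T\lambda\cdot\lambda T$. Here $S=P$ and $T=M$. *)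

(* Defs.v *)
From mathcomp Require Import all_boot finmap.
From mathcomp Require Import boolp classical_sets functions cardinality fsbigop.

Set Implicit Arguments.
Unset Strict Implicit.
Unset Printing Implicit Defensive.

Local Open Scope classical_set_scope.

(* The category Set is the universe [Type] with all functions as morphisms;
   equations between morphisms are stated pointwise. *)

Record monad := Monad {
  mobj :> Type -> Type;
  mmap : forall X Y : Type, (X -> Y) -> mobj X -> mobj Y;
  munit : forall X : Type, X -> mobj X;
  mjoin : forall X : Type, mobj (mobj X) -> mobj X;
  mmap_id : forall X (u : mobj X), mmap id u = u;
  mmap_comp : forall X Y Z (f : X -> Y) (g : Y -> Z) (u : mobj X),
    mmap (g \o f) u = mmap g (mmap f u);
  munit_natural : forall X Y (f : X -> Y) (x : X),
    mmap f (munit x) = munit (f x);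
  mjoin_natural : forall X Y (f : X -> Y) (u : mobj (mobj X)),
    mmap f (mjoin u) = mjoin (mmap (mmap f) u);
  mjoin_munit : forall X (u : mobj X), mjoin (munit u) = u;
  mjoin_mmap_munit : forall X (u : mobj X), mjoin (mmap (@munit X) u) = u;
  mjoin_assoc : forall X (u : mobj (mobj (mobj X))),
    mjoin (mjoin u) = mjoin (mmap (@mjoin X) u)
}.

Arguments mmap m {X Y} f u.
Arguments munit m {X} x.
Arguments mjoin m {X} u.

Record is_distributive_law (S T : monad)
    (lam : forall X : Type, S (T X) -> T (S X)) : Prop := IsDistributiveLaw {
  dlaw_natural : forall X Y (f : X -> Y) (u : S (T X)),
    lam Y (mmap S (mmap T f) u) = mmap T (mmap S f) (lam X u);
  dlaw_unitS : forall X (t : T X),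
    lam X (munit S t) = mmap T (munit S) t;
  dlaw_unitT : forall X (s : S X),
    lam X (mmap S (munit T) s) = munit T s;
  dlaw_joinS : forall X (u : S (S (T X))),
    lam X (mjoin S u) = mmap T (mjoin S) (lam (S X) (mmap S (lam X) u));
  dlaw_joinT : forall X (u : S (T (T X))),
    lam X (mmap S (mjoin T) u) = mjoin T (mmap T (lam X) (lam (T X) u))
}.

Record fin_subset (X : Type) := FinSubset {
  fin_subset_set :> set X;
  fin_subset_finite : finite_set fin_subset_set
}.

Lemma fin_subset_eq X (A B : fin_subset X) : (A : set X) = B -> A = B.
Proof.
case: A B => [A Af] [B Bf] /= AB; subst B.
by congr FinSubset; exact: Prop_irrelevance.
Qed.

Definition fin_subset_map X Y (f : X -> Y) (A : fin_subset X) : fin_subset Y :=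
  FinSubset (finite_image f (fin_subset_finite A)).

Definition fin_subset_unit X (x : X) : fin_subset X :=
  FinSubset (finite_set1 x).

Lemma fin_subset_join_finite X (AA : fin_subset (fin_subset X)) :
  finite_set (\bigcup_(A in (AA : set (fin_subset X))) (A : set X)).
Proof.
apply: bigcup_finite => [|A _]; first exact: fin_subset_finite.
exact: fin_subset_finite.
Qed.

Definition fin_subset_join X (AA : fin_subset (fin_subset X)) : fin_subset X :=
  FinSubset (fin_subset_join_finite AA).

Lemma fin_subset_map_id X (A : fin_subset X) : fin_subset_map id A = A.
Proof. by apply: fin_subset_eq; rewrite /= image_id. Qed.

Lemma fin_subset_map_comp X Y Z (f : X -> Y) (g : Y -> Z) (A : fin_subset X) :
  fin_subset_map (g \o f) A = fin_subset_map g (fin_subset_map f A).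
Proof. by apply: fin_subset_eq; rewrite /= image_comp. Qed.

Lemma fin_subset_unit_natural X Y (f : X -> Y) (x : X) :
  fin_subset_map f (fin_subset_unit x) = fin_subset_unit (f x).
Proof. by apply: fin_subset_eq; rewrite /= image_set1. Qed.

Lemma fin_subset_join_natural X Y (f : X -> Y)
    (AA : fin_subset (fin_subset X)) :
  fin_subset_map f (fin_subset_join AA) =
  fin_subset_join (fin_subset_map (fin_subset_map f) AA).
Proof. by apply: fin_subset_eq; rewrite /= image_bigcup bigcup_image. Qed.

Lemma fin_subset_join_unit X (A : fin_subset X) :
  fin_subset_join (fin_subset_unit A) = A.
Proof. by apply: fin_subset_eq; rewrite /= bigcup_set1. Qed.

Lemma fin_subset_join_map_unit X (A : fin_subset X) :
  fin_subset_join (fin_subset_map (@fin_subset_unit X) A) = A.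
Proof.
by apply: fin_subset_eq; rewrite /= bigcup_image bigcup_imset1 image_id.
Qed.

Lemma fin_subset_join_assoc X
    (AAA : fin_subset (fin_subset (fin_subset X))) :
  fin_subset_join (fin_subset_join AAA) =
  fin_subset_join (fin_subset_map (@fin_subset_join X) AAA).
Proof.
apply: fin_subset_eq; rewrite /= bigcup_image.
apply/seteqP; split=> x /=.
  by move=> [A [B AAAB BA] Ax]; exists B => //; exists A.
by move=> [B AAAB [A BA Ax]]; exists A => //; exists B.
Qed.

Definition powerset_monad : monad :=
  Monad fin_subset_map_id fin_subset_map_comp
    fin_subset_unit_natural fin_subset_join_natural
    fin_subset_join_unit fin_subset_join_map_unit fin_subset_join_assoc.

Record multiset (X : Type) := Multiset {
  mult :> X -> nat;
  mult_finite : finite_set [set x | mult x <> 0]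
}.

Lemma multiset_eq X (m n : multiset X) : (forall x, m x = n x) -> m = n.
Proof.
case: m n => [m mf] [n nf] /= /funext mn; subst n.
by congr Multiset; exact: Prop_irrelevance.
Qed.

(* [{classic X}] is [X] with a choice structure, which finitely supported sums
   require of their index type.  The sums below have finite support (because [m],
   resp. [Phi], does), so the default value [0] used by the library for sums of
   infinite support never intervenes. *)
Definition multiset_map_fun X Y (f : X -> Y) (m : multiset X) (y : Y) : nat :=
  \big[addn/0]_(x \in (f @^-1` [set y] : set {classic X})) m x.

Definition multiset_unit_fun X (x y : X) : nat := `[< y = x >].

Definition multiset_join_fun X (Phi : multiset (multiset X)) (x : X) : nat :=
  \big[addn/0]_(m \in [set: {classic multiset X}]) (Phi m * (m : multiset X) x).

Lemma multiset_map_finite X Y (f : X -> Y) (m : multiset X) :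
  finite_set [set y | multiset_map_fun f m y <> 0].
Proof.
apply: sub_finite_set (finite_image f (mult_finite m)) => y /=.
move=> /eqP /(@fsbigN1 _ _ _ unit {classic X} _ (fun _ x => m x) tt).
by move=> [x fxy mx]; exists x => //; exact/eqP.
Qed.

Lemma multiset_unit_finite X (x : X) :
  finite_set [set y | multiset_unit_fun x y <> 0].
Proof.
apply: sub_finite_set (finite_set1 x) => y /=.
by rewrite /multiset_unit_fun; case: asboolP.
Qed.

Lemma multiset_join_finite X (Phi : multiset (multiset X)) :
  finite_set [set x | multiset_join_fun Phi x <> 0].
Proof.
apply: (@sub_finite_set _ _ (\bigcup_(m in [set m | Phi m <> 0])
  [set x | (m : multiset X) x <> 0])); last first.
  by apply: bigcup_finite => [|m _]; exact: mult_finite.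
move=> x /= /eqP /(@fsbigN1 _ _ _ unit {classic multiset X} _
  (fun _ m => Phi m * (m : multiset X) x) tt) [m _].
by rewrite muln_eq0 negb_or => /andP[/eqP Pm /eqP mx]; exists m.
Qed.

Definition multiset_map X Y (f : X -> Y) (m : multiset X) : multiset Y :=
  Multiset (multiset_map_finite f m).

Definition multiset_unit X (x : X) : multiset X :=
  Multiset (multiset_unit_finite x).

Definition multiset_join X (Phi : multiset (multiset X)) : multiset X :=
  Multiset (multiset_join_finite Phi).

(* The pairing of [m] with [F : X -> nat]: a multiset is determined by its
   pairings, and the monad operations are transparent on them. *)
Definition mpair X (m : multiset X) (F : X -> nat) : nat :=
  \big[addn/0]_(x \in [set: {classic X}]) (m x * F x).

Definition msupp X (m : multiset X) : {fset {classic X}} :=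
  fset_set [set x : {classic X} | m x <> 0].

Lemma notin_msupp X (m : multiset X) x : x \notin msupp m -> m x = 0.
Proof.
rewrite /msupp in_fset_set; last exact: (mult_finite m).
by rewrite notin_setE /= => /contrapT.
Qed.

Lemma mpair_seq X (m : multiset X) (A : {fset {classic X}}) F :
  (forall x, x \notin A -> m x = 0) ->
  mpair m F = \sum_(x <- A) m x * F x.
Proof. by move=> mA; apply: fsbigTE => x /mA ->. Qed.

Lemma mpair_supp X (m : multiset X) F :
  mpair m F = \sum_(x <- msupp m) m x * F x.
Proof. by apply: mpair_seq => x; exact: notin_msupp. Qed.

Lemma eq_mpair X (m : multiset X) F G : F =1 G -> mpair m F = mpair m G.
Proof. by move=> /funext ->. Qed.

Lemma sum_point X (A : {fset {classic X}}) (a : X) (F : X -> nat) :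
  (a : {classic X}) \in A -> \sum_(x <- A) `[< x = a >] * F x = F a.
Proof.
move=> aA; rewrite (bigD1_seq (a : {classic X})) ?fset_uniq//= asboolT//.
rewrite mul1n big1 ?addn0// => x /eqP xa.
by rewrite asboolF.
Qed.

Lemma mpair_point X (m : multiset X) a : mpair m (fun x => `[< x = a >]) = m a.
Proof.
rewrite (@mpair_seq _ _ ((a : {classic X}) |` msupp m)%fset).
  by under eq_bigr do rewrite mulnC; rewrite sum_point// fset1U1.
by move=> x; rewrite in_fset1U negb_or => /andP[_]; exact: notin_msupp.
Qed.

Lemma multiset_mapE X Y (f : X -> Y) (m : multiset X) y :
  multiset_map f m y = mpair m (fun x => `[< f x = y >]).
Proof.
rewrite /= /multiset_map_fun fsbig_mkcond; apply: eq_fsbigr => x _.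
rewrite /patch; case: ifPn; rewrite ?notin_setE ?inE/= => fxy.
  by rewrite asboolT// muln1.
by rewrite asboolF// muln0.
Qed.

Lemma multiset_joinE X (Phi : multiset (multiset X)) x :
  multiset_join Phi x = mpair Phi (fun m => m x).
Proof. by []. Qed.

Lemma mpair_unit X (x : X) F : mpair (multiset_unit x) F = F x.
Proof.
rewrite (@mpair_seq _ _ [fset (x : {classic X})]%fset).
  by rewrite /= /multiset_unit_fun sum_point// fset11.
move=> y; rewrite in_fset1 => /eqP yx.
by rewrite /= /multiset_unit_fun asboolF.
Qed.

Lemma mpair_map X Y (f : X -> Y) (m : multiset X) F :
  mpair (multiset_map f m) F = mpair m (F \o f).
Proof.
pose g : {classic X} -> {classic Y} := f.
rewrite (@mpair_seq _ _ (g @` msupp m)%fset); last first.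
  move=> y yN; rewrite multiset_mapE mpair_supp big1_seq// => x /= xm.
  rewrite asboolF ?muln0// => fxy; move/negP: yN; apply.
  by apply/imfsetP; exists x.
under eq_bigr do rewrite multiset_mapE mpair_supp big_distrl.
rewrite /= exchange_big /= mpair_supp; apply: eq_big_seq => x xm.
under eq_bigr do rewrite -mulnA.
rewrite -big_distrr /=; congr muln.
rewrite -[RHS](@sum_point _ (g @` msupp m)%fset); last first.
  by apply/imfsetP; exists x.
apply: eq_bigr => y _; congr (nat_of_bool _ * _).
by apply: asbool_equiv_eq; split=> ->.
Qed.

Lemma mpair_join X (Phi : multiset (multiset X)) F :
  mpair (multiset_join Phi) F = mpair Phi (fun m => mpair m F).
Proof.
set B := (\bigcup_(m <- msupp Phi) msupp (m : multiset X))%fset.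
have mB m : m \in msupp Phi -> forall x, x \notin B -> (m : multiset X) x = 0.
  move=> mPhi x xB; apply: notin_msupp; apply: contra xB => xm.
  by apply/bigfcupP; exists m; rewrite ?mPhi.
rewrite (@mpair_seq _ _ B); last first.
  move=> x xB; rewrite multiset_joinE mpair_supp big1_seq// => m /= mPhi.
  by rewrite (mB m) ?muln0.
under eq_bigr do rewrite multiset_joinE mpair_supp big_distrl.
rewrite /= exchange_big /= mpair_supp; apply: eq_big_seq => m mPhi.
under eq_bigr do rewrite -mulnA.
by rewrite -big_distrr /= (mpair_seq _ (mB m mPhi)).
Qed.

Lemma multiset_eq_mpair X (m n : multiset X) :
  (forall F, mpair m F = mpair n F) -> m = n.
Proof. by move=> mn; apply: multiset_eq => x; rewrite -!mpair_point. Qed.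

Lemma multiset_map_id X (m : multiset X) : multiset_map id m = m.
Proof. by apply: multiset_eq_mpair => F; rewrite mpair_map. Qed.

Lemma multiset_map_comp X Y Z (f : X -> Y) (g : Y -> Z) (m : multiset X) :
  multiset_map (g \o f) m = multiset_map g (multiset_map f m).
Proof. by apply: multiset_eq_mpair => F; rewrite !mpair_map. Qed.

Lemma multiset_unit_natural X Y (f : X -> Y) (x : X) :
  multiset_map f (multiset_unit x) = multiset_unit (f x).
Proof. by apply: multiset_eq_mpair => F; rewrite mpair_map !mpair_unit. Qed.

Lemma multiset_join_natural X Y (f : X -> Y)
    (Phi : multiset (multiset X)) :
  multiset_map f (multiset_join Phi) =
  multiset_join (multiset_map (multiset_map f) Phi).
Proof.
apply: multiset_eq_mpair => F; rewrite mpair_map !mpair_join mpair_map.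
by apply: eq_mpair => m; rewrite /= mpair_map.
Qed.

Lemma multiset_join_unit X (m : multiset X) :
  multiset_join (multiset_unit m) = m.
Proof. by apply: multiset_eq_mpair => F; rewrite mpair_join mpair_unit. Qed.

Lemma multiset_join_map_unit X (m : multiset X) :
  multiset_join (multiset_map (@multiset_unit X) m) = m.
Proof.
apply: multiset_eq_mpair => F; rewrite mpair_join mpair_map.
by apply: eq_mpair => x; rewrite /= mpair_unit.
Qed.

Lemma multiset_join_assoc X (Psi : multiset (multiset (multiset X))) :
  multiset_join (multiset_join Psi) =
  multiset_join (multiset_map (@multiset_join X) Psi).
Proof.
apply: multiset_eq_mpair => F; rewrite !mpair_join mpair_map.
by apply: eq_mpair => Phi; rewrite /= mpair_join.
Qed.

Definition multiset_monad : monad :=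
  Monad multiset_map_id multiset_map_comp
    multiset_unit_natural multiset_join_natural
    multiset_join_unit multiset_join_map_unit multiset_join_assoc.

(* Main.v *)
Require Import Defs.
From mathcomp Require Import all_boot finmap.
From mathcomp Require Import boolp classical_sets functions cardinality fsbigop.

Set Implicit Arguments.
Unset Strict Implicit.
Unset Printing Implicit Defensive.

Local Open Scope classical_set_scope.

(** Naturality and the unit law for [P] already conflict.  Take
    [u = {a0 + a1, b0 + b1}] over four points.  Both the identification
    [a0 = b0, a1 = b1] and the identification [a0 = b1, a1 = b0] turn [u] into a
    singleton, whose image under [lam] is [{x} + {y}].  Hence each set occurring
    in [lam u] has singleton image under both identifications, so is itself a
    singleton, and [{a0}], [{b0}] have total multiplicity one in [lam u].  But
    exchanging [a]'s with [b]'s fixes [u], so these two multiplicities agree. *)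

Lemma mpairD X (m : multiset X) F G :
  mpair m (fun x => F x + G x) = mpair m F + mpair m G.
Proof.
by rewrite !mpair_supp -big_split; apply: eq_bigr => x _; rewrite mulnDr.
Qed.

Lemma eq_in_mpair X (m : multiset X) F G :
  (forall x, m x <> 0 -> F x = G x) -> mpair m F = mpair m G.
Proof.
move=> FG; rewrite !mpair_supp; apply: eq_bigr => x _.
by case: (eqVneq (m x) 0) => [->//|/eqP /FG ->].
Qed.

(** Multiplicities are natural numbers, so nothing can cancel the summand [m x] in the fibre sum at
    [f x]. *)
Lemma multiset_map_neq0 X Y (f : X -> Y) (m : multiset X) x :
  m x <> 0 -> multiset_map f m (f x) <> 0.
Proof.
move=> mx; rewrite multiset_mapE mpair_supp => /eqP.
rewrite sum_nat_seq_eq0 => /allP/(_ (x : {classic X})).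
rewrite asboolT// muln1 => xm; apply: (mx); apply/eqP/xm.
by apply: contra_notT mx; exact: notin_msupp.
Qed.

Lemma multiset_map_neq0_inv X Y (f : X -> Y) (m : multiset X) y :
  multiset_map f m y <> 0 -> exists2 x, m x <> 0 & f x = y.
Proof.
move=> /eqP /(@fsbigN1 _ _ _ unit {classic X} _ (fun _ x => m x) tt).
by move=> [x fxy /eqP mx]; exists x.
Qed.

Lemma multiset_map_inj X Y (f : X -> Y) (m : multiset X) x :
  injective f -> multiset_map f m (f x) = m x.
Proof.
move=> finj; rewrite multiset_mapE -[RHS]mpair_point; apply: eq_mpair => z.
by congr nat_of_bool; apply: asbool_equiv_eq; split=> [/finj|->].
Qed.

Lemma fin_subset_unit_inj X : injective (@fin_subset_unit X).
Proof.
move=> x y /(congr1 (@fin_subset_set X)) /= xy.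
have : [set y] x by rewrite -xy.
by [].
Qed.

Lemma finite_setT_bool : finite_set [set: bool].
Proof. exact: finite_finset. Qed.

Definition bools : fin_subset bool := FinSubset finite_setT_bool.

(** The multiplicity function is inferred from the support [[set b | 1 <> 0]]: it is constantly
    1. *)
Definition both : multiset bool :=
  Multiset (sub_finite_set (@subsetT _ [set b | 1 <> 0]) finite_setT_bool).

Lemma fin_subset_map_bools_const X (x : X) :
  fin_subset_map (fun=> x) bools = fin_subset_unit x.
Proof.
apply: fin_subset_eq; apply/seteqP; split=> y /= => [[_ _ ->]//|->].
by exists true.
Qed.

Lemma fin_subset_map_bools_inv (f : bool -> bool) :
  involutive f -> fin_subset_map f bools = bools.
Proof.
move=> fK; apply: fin_subset_eq; apply/seteqP; split=> //= b _.
by exists (f b).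
Qed.

Lemma multiset_map_both_inv (f : bool -> bool) :
  involutive f -> multiset_map f both = both.
Proof.
move=> fK; apply: multiset_eq => b.
by rewrite -[b]fK (multiset_map_inj _ _ (inv_inj fK)).
Qed.

(* The point [(i, j)] is [a_j] for [i = false] and [b_j] for [i = true]. *)
Definition row (i : bool) : multiset (bool * bool) :=
  multiset_map (pair i) both.

Definition rows : fin_subset (multiset (bool * bool)) :=
  fin_subset_map row bools.

Section NaturalUnital.

Variable lam : forall X : Type,
  fin_subset (multiset X) -> multiset (fin_subset X).
Hypothesis lam_natural : forall X Y (f : X -> Y) u,
  lam (fin_subset_map (multiset_map f) u) =
  multiset_map (fin_subset_map f) (lam u).
Hypothesis lam_unit : forall X (m : multiset X),
  lam (fin_subset_unit m) = multiset_map (@fin_subset_unit X) m.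

(** On each row [f] is a permutation of [bool], so it sends every row to [both] and [rows] to the
    singleton of [both], where the unit law computes [lam]. *)
Lemma lam_rows_merge (f : bool * bool -> bool) :
  (forall i, involutive (fun j => f (i, j))) ->
  multiset_map (fin_subset_map f) (lam rows) =
  multiset_map (@fin_subset_unit bool) both.
Proof.
move=> fK; rewrite -lam_natural -lam_unit -fin_subset_map_comp.
rewrite -fin_subset_map_bools_const; congr (lam (fin_subset_map _ _)).
apply/funext => i /=; rewrite /row -multiset_map_comp.
exact: multiset_map_both_inv (fK i).
Qed.

Lemma lam_rows_merge_unit f (S : fin_subset (bool * bool)) :
  (forall i, involutive (fun j => f (i, j))) -> lam rows S <> 0 ->
  exists b, fin_subset_map f S = fin_subset_unit b.
Proof.
move=> fK LS; have := multiset_map_neq0 (f := fin_subset_map f) LS.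
rewrite lam_rows_merge// => LfS.
by have [b _ <-] := multiset_map_neq0_inv LfS; exists b.
Qed.

Lemma lam_rows_swap i j :
  lam rows (fin_subset_unit (~~ i, j)) = lam rows (fin_subset_unit (i, j)).
Proof.
pose swap (p : bool * bool) := (~~ p.1, p.2).
have swapK : involutive swap by move=> [k l]; rewrite /swap negbK.
have swap_rows : fin_subset_map (multiset_map swap) rows = rows.
  rewrite -fin_subset_map_comp /rows -[in RHS](fin_subset_map_bools_inv negbK).
  rewrite -fin_subset_map_comp; congr fin_subset_map; apply/funext => k /=.
  by rewrite /row -multiset_map_comp.
rewrite -{1}swap_rows lam_natural -(fin_subset_unit_natural swap (i, j)).
(* Direct image under [swap] is again an involution, hence injective, so it preserves
   multiplicities. *)
apply: multiset_map_inj; apply: (can_inj (g := fin_subset_map swap)) => S.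
rewrite -fin_subset_map_comp -[RHS]fin_subset_map_id.
by congr fin_subset_map; apply/funext => p /=; rewrite swapK.
Qed.

Lemma lam_rows_unit (S : fin_subset (bool * bool)) :
  lam rows S <> 0 -> exists p, S = fin_subset_unit p.
Proof.
move=> LS.
have [|b /(congr1 (@fin_subset_set _)) /= Sb] :=
  lam_rows_merge_unit (f := snd) _ LS; first by [].
(* Addition modulo 2 is the crossed identification: a0 with b1, and a1 with b0. *)
have [|c /(congr1 (@fin_subset_set _)) /= Sc] :=
  lam_rows_merge_unit (f := fun p => p.1 (+) p.2) _ LS.
  by move=> i j; rewrite addKb.
(* The values of both identifications determine a point, so [S] has at most one element. *)
have Sp p : (S : set _) p -> p = (b (+) c, b).
  case: p => i j Sij.
  have -> : b = j by have : [set b] j by [rewrite -Sb; exists (i, j)].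
  have -> : c = i (+) j by have : [set c] (i (+) j) by [rewrite -Sc; exists (i, j)].
  by rewrite addbC addbK.
exists (b (+) c, b); apply: fin_subset_eq; apply/seteqP; split=> [p /Sp//|_ ->].
(* [S] is nonempty because its image under [snd] is. *)
have [p pS _] : (snd @` (S : set _)) b by rewrite Sb.
by rewrite -(Sp p).
Qed.

Lemma natural_unital_absurd : False.
Proof.
have : multiset_map (fin_subset_map snd) (lam rows) (fin_subset_unit false) = 1.
  by rewrite lam_rows_merge// (multiset_map_inj _ _ (@fin_subset_unit_inj bool)).
(* The two indicators agree on singletons, hence on the support of [lam rows], but not on {a0,
   b0}. *)
rewrite multiset_mapE (@eq_in_mpair _ _ _ (fun S =>
  `[< S = fin_subset_unit (false, false) >] +
  `[< S = fin_subset_unit (true, false) >])).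
  (* The swap makes the two multiplicities equal, so their sum 1 would be even. *)
  rewrite mpairD !mpair_point (lam_rows_swap false) addnn => /(congr1 odd).
  by rewrite odd_double.
move=> S /lam_rows_unit[[i j] ->]; rewrite fin_subset_unit_natural /=.
have unitE (Y : eqType) (x y : Y) :
    `[< fin_subset_unit x = fin_subset_unit y >] = (x == y).
  by apply/asboolP/eqP => [xy|->//]; exact: fin_subset_unit_inj xy.
by rewrite !unitE; case: i; case: j.
Qed.

End NaturalUnital.

Theorem mainTheorem9 :
  ~ exists lam : forall X : Type,
      powerset_monad (multiset_monad X) -> multiset_monad (powerset_monad X),
    is_distributive_law lam.
Proof.
move=> [lam [lam_natural lam_unit _ _ _]].
exact: (natural_unital_absurd lam_natural lam_unit).
Qed.
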